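(* For every $\epsilon > 0$ there exists $p_0(\epsilon)$ such that for every prime $p \equiv 1 \pmod{4}$ with $p > p_0(\epsilon)$, \[ \#\{\text{primes } q < p^{\frac{1}{2}+\epsilon} : q^{\ast} \text{ is a biquadratic residue modulo } p\} > p^{\frac{1}{50}\epsilon}. \]
   Context: For an odd prime $q$, $q^{\ast} := (-1)^{(q-1)/2} q$, so that $q^{\ast} = \pm q$ and $q^{\ast} \equiv 1 \pmod 4$. An integer $a$ is a biquadratic residue modulo the prime $p$ if $a \equiv y^4 \pmod{p}$ for some integer $y$ with $p \nmid y$. (The primes $q$ counted are odd primes, since $q^\ast$ is only defined for odd $q$.) *)

(* Defs.v *)
From Stdlib Require Import Reals ZArith Znumtheory List.
Open Scope R_scope.

Definition qstar (q : Z) : Z :=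
  if Z.even ((q - 1) / 2) then q else (- q)%Z.

Definition biquad_res (a p : Z) : Prop :=
  exists y : Z, ~ (p | y)%Z /\ Z.modulo (a - y ^ 4) p = 0%Z.

Definition counted_set (p : Z) (eps : R) (q : Z) : Prop :=
  prime q /\ Z.odd q = true /\
  IZR q < Rpower (IZR p) (/ 2 + eps) /\ biquad_res (qstar q) p.

(* Main.v *)
(** Let [J = a + b i] be the Jacobi sum of a quartic character modulo [p], so
    that [p = a^2 + b^2], and let [f(u) = Im (J (u - i)^4)].  If an odd prime
    [q <> p] divides [f(u)], then in a field of characteristic [q] we have
    [J' / J = w^4] with [J'] the conjugate of [J] and [w = (u - i) / (u + i)].
    The quartic Gauss sum [G] satisfies
    [G^4 = J^3 J' = (J w)^4], and comparing [G^q] computed by Frobenius with the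
    [q]-th power of [J w] shows that [q*] is a biquadratic residue modulo [p].

    The values [f(u)] for [u] of size [T ~ p^(eps/5)] are below [p^(1/2+eps)].
    For [q <> 2, p] the polynomial [f] has only simple roots modulo [q], hence
    at most 4 roots modulo [q^j], and [u] is chosen so that 16 does not divide
    [f(u)].  If only [k <= p^(eps/50)] primes [q] were available, then bounding
    the [q]-part of the product of the [f(u)] for all of them would make this
    product smaller than its trivial lower bound.  The sum of [log q / q] over
    these primes is controlled, in place of Mertens' theorem, by the
    factorization of [N!] with [N ~ 100 k]. *)

Require Import Defs.
From Stdlib Require Import Reals ZArith Znumtheory List Lia Lra Classical.
From mathcomp Require all_boot all_order all_algebra all_fingroup all_solvable all_field.
From mathcomp Require ring zify.
Open Scope R_scope.

(** * Quartic Gauss sums and rational reciprocity *)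

Section QuarticReciprocity.
Import all_boot all_order all_algebra all_fingroup all_solvable all_field ring zify.
Import GRing.Theory.
Local Set Implicit Arguments.
Local Unset Strict Implicit.
Local Open Scope ring_scope.

(** * Gauss and Jacobi sums over the field with [p] elements *)

Definition mulchar (p : nat) (L : fieldType) (chi : 'F_p -> L) : Prop :=
  [/\ chi 0 = 0, chi 1 = 1 & {morph chi : x y / x * y}].

Definition gauss (p : nat) (L : fieldType) (z : L) (chi : 'F_p -> L) : L :=
  \sum_x chi x * z ^+ x.

Definition jacobi (p : nat) (L : fieldType) (chi : 'F_p -> L) : L :=
  \sum_x chi x * chi (1 - x).

Lemma expr_Fp_nat (p : nat) (L : fieldType) (z : L) (n : nat) :
  prime p -> z ^+ p = 1 -> z ^+ (n%:R : 'F_p) = z ^+ n.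
Proof. by move=> pp zp; rewrite val_Fp_nat // expr_mod. Qed.

Lemma expr_FpD (p : nat) (L : fieldType) (z : L) (x y : 'F_p) :
  prime p -> z ^+ p = 1 -> z ^+ (x + y)%R = z ^+ x * z ^+ y.
Proof.
move=> pp zp; rewrite -{1}(natr_Zp x) -{1}(natr_Zp y) -natrD.
by rewrite expr_Fp_nat // exprD.
Qed.

Lemma sum_expr_Fp (p : nat) (L : fieldType) (z : L) (a : 'F_p) :
  prime p -> p.-primitive_root z ->
  \sum_(y : 'F_p) z ^+ (a * y)%R = if a == 0 then p%:R else 0.
Proof.
move=> pp pz; have zp := prim_expr_order pz.
case: eqP => [-> | /eqP a0].
  under eq_bigr do rewrite mul0r expr0.
  by rewrite sumr_const card_Fp.
have H : \sum_(y : 'F_p) z ^+ (a * y)%R = (\sum_(y : 'F_p) z ^+ (a * y)%R) * z ^+ a.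
  rewrite {1}(reindex_inj (addIr (1 : 'F_p))) mulr_suml.
  apply: eq_bigr => y _; rewrite -expr_FpD //.
  by congr (_ ^+ nat_of_ord _); rewrite [LHS]mulrDr mulr1.
have za : z ^+ a != 1.
  rewrite -(expr0 z) (eq_prim_root_expr pz) mod0n.
  have := ltn_ord a; rewrite [X in (_ < X)%N]Fp_cast // => alt.
  rewrite modn_small //; apply: contra a0 => /eqP h; apply/eqP/val_inj; exact: h.
have : (\sum_y z ^+ (a * y)%R) * (1 - z ^+ a) = 0.
  by rewrite mulrBr mulr1 -H subrr.
by move/eqP; rewrite mulf_eq0 subr_eq0 [1 == _]eq_sym (negPf za) orbF => /eqP.
Qed.

Lemma mulchar_sum0 (p : nat) (L : fieldType) (chi : 'F_p -> L) (a : 'F_p) :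
  mulchar chi -> a != 0 -> chi a != 1 -> \sum_x chi x = 0.
Proof.
move=> [c0 c1 cM] a0 ca.
have H : \sum_x chi x = chi a * \sum_x chi x.
  rewrite {1}(reindex_inj (mulfI a0)) mulr_sumr.
  by apply: eq_bigr => x _; rewrite /= cM.
have : (1 - chi a) * (\sum_x chi x) = 0 by rewrite mulrBl mul1r -H subrr.
by move/eqP; rewrite mulf_eq0 subr_eq0 [1 == _]eq_sym (negPf ca) => /eqP.
Qed.

Lemma gauss_dilate (p : nat) (L : fieldType) (z : L) (chi : 'F_p -> L) (a : 'F_p) :
  mulchar chi -> a != 0 ->
  chi a * (\sum_x chi x * z ^+ (a * x)%R) = gauss z chi.
Proof.
move=> [c0 c1 cM] a0; rewrite /gauss [RHS](reindex_inj (mulfI a0)) mulr_sumr.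
by apply: eq_bigr => x _; rewrite cM mulrA.
Qed.

(** Substituting [x = y * t] leaves sums over [y] of [z ^+ ((t + 1) * y)], of which orthogonality
    keeps only [t = -1]. The terms with [y = 0] may be added because [chi] sums to 0. *)
Lemma gauss_mul_inv (p : nat) (L : fieldType) (z : L) (chi chi' : 'F_p -> L) :
  prime p -> p.-primitive_root z -> mulchar chi -> mulchar chi' ->
  (forall x, x != 0 -> chi x * chi' x = 1) -> \sum_x chi x = 0 ->
  gauss z chi * gauss z chi' = chi (-1) * p%:R.
Proof.
move=> pp pz Hc [c0' c1' cM'] inv s0; have [c0 c1 cM] := Hc.
have zp := prim_expr_order pz.
have -> : gauss z chi * gauss z chi' =
   \sum_(y : 'F_p) \sum_(t : 'F_p | y != 0) chi t * z ^+ ((t + 1) * y)%R.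
  rewrite mulrC /gauss mulr_suml; apply: eq_bigr => y _.
  case: (eqVneq y 0) => [-> | y0].
    by rewrite c0' !mul0r big_pred0.
  rewrite (reindex_inj (mulfI y0)) mulr_sumr; apply: eq_bigr => t _.
  have -> : (t + 1) * y = y * t + y by rewrite mulrDl mul1r mulrC.
  rewrite expr_FpD // cM mulrACA [chi' y * _]mulrA [chi' y * _]mulrC inv // mul1r.
  by congr (_ * _); rewrite mulrC.
have -> : \sum_(y : 'F_p) \sum_(t : 'F_p | y != 0) chi t * z ^+ ((t + 1) * y)%R
  = \sum_(y : 'F_p) \sum_(t : 'F_p) chi t * z ^+ ((t + 1) * y)%R.
  apply: eq_bigr => y _; case: (eqVneq y 0) => [-> | //].
  rewrite big_pred0 //; under eq_bigr do rewrite mulr0 expr0 mulr1.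
  by rewrite s0.
rewrite exchange_big.
transitivity (\sum_t chi t * (if t == -1 then p%:R else 0)).
  by apply: eq_bigr => t _; rewrite -mulr_sumr sum_expr_Fp // addr_eq0.
rewrite (bigD1 (-1)) //= eqxx big1 ?addr0 // => t /negPf ->.
by rewrite mulr0.
Qed.

(** The terms with [x + y = s] are collected. Scaling by a nonzero [s] gives [chi2 s] times the
    Jacobi sum; at [s = 0] the inner sum is [chi (-1)] times the sum of [chi2], which is 0. *)
Lemma gauss_sqr (p : nat) (L : fieldType) (z : L) (chi chi2 : 'F_p -> L) :
  prime p -> p.-primitive_root z -> mulchar chi ->
  (forall x, chi2 x = chi x ^+ 2) -> \sum_x chi2 x = 0 ->
  gauss z chi ^+ 2 = jacobi chi * gauss z chi2.
Proof.
move=> pp pz [c0 c1 cM] c2 s0; have zp := prim_expr_order pz.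
have -> : gauss z chi ^+ 2 =
   \sum_(s : 'F_p) (\sum_(x : 'F_p) chi x * chi (s - x)) * z ^+ s.
  rewrite expr2 {1}/gauss mulr_suml.
  under [RHS]eq_bigr do rewrite mulr_suml.
  rewrite exchange_big /=; apply: eq_bigr => x _.
  rewrite [RHS](reindex_inj (addrI x)) mulr_sumr; apply: eq_bigr => y _.
  by rewrite addrAC subrr add0r expr_FpD // mulrACA.
rewrite /gauss mulr_sumr; apply: eq_bigr => s _.
rewrite mulrA; congr (_ * _).
case: (eqVneq s 0) => [-> | s0'].
  rewrite c2 c0 expr0n mulr0.
  transitivity (chi (-1) * \sum_x chi2 x); last by rewrite s0 mulr0.
  rewrite mulr_sumr; apply: eq_bigr => x _.
  by rewrite sub0r -[- x]mulN1r cM c2 mulrCA.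
rewrite (reindex_inj (mulfI s0')) /jacobi mulr_suml; apply: eq_bigr => x _.
rewrite cM -[X in X - _]mulr1 -mulrBr cM c2; ring.
Qed.

(* A quartic character with values in an arbitrary field is encoded by an
   exponent [e] that is additive modulo 4, so that one integer Jacobi sum serves
   both [algC] and characteristic [q]. *)
Definition quartic_log (p : nat) (e : 'F_p -> nat) : Prop :=
  [/\ forall x y, x != 0 -> y != 0 -> e (x * y) = (e x + e y)%N %[mod 4],
      exists2 g, g != 0 & e g = 1%N %[mod 4]
    & forall x, x != 0 -> (4 %| e x)%N -> exists2 y, y != 0 & x = y ^+ 4].

Lemma finField_generator (F : finFieldType) :
  exists g : F, (#|F|.-1).-primitive_root g.
Proof.
have /hasP [g _ gP] : has (#|F|.-1).-primitive_root [seq x <- enum F | x != 0].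
  apply: has_prim_root.
  - by rewrite -subn1 subn_gt0 finRing_gt1.
  - apply/allP => x; rewrite mem_filter => /andP [x0 _]; apply/unity_rootP.
    apply: (mulfI x0); rewrite -exprS prednK ?mulr1 ?expf_card //.
    by rewrite ltnW // finRing_gt1.
  - by rewrite filter_uniq // enum_uniq.
  - have -> : size [seq x <- enum F | x != 0] = #|[pred x : F | x != 0]|.
      by rewrite cardE /enum_mem -filter_predI; congr size; apply: eq_filter => x; rewrite /= andbT.
    have := cardC (pred1 (0 : F)); rewrite card1 => h.
    by rewrite -{1}h.
by exists g.
Qed.

(** A discrete logarithm to a primitive root is additive modulo [p.-1], hence modulo 4. *)
Lemma quartic_log_exists (p : nat) :
  prime p -> (p %% 4)%N = 1%N -> exists e : 'F_p -> nat, quartic_log e.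
Proof.
move=> pp p4; have p1 : (3 < p.-1)%N.
  by have := prime_gt1 pp; move: p4 {pp}; lia.
have d4 : (4 %| p.-1)%N by move: p4 p1 {pp}; lia.
have [g gP] := finField_generator 'F_p; rewrite card_Fp // in gP.
have g0 : g != 0.
  apply/eqP => g00; move: (prim_expr_order gP) => /eqP.
  by rewrite g00 expr0n (gtn_eqF (leq_trans _ p1)) // eq_sym oner_eq0.
have ex x : x != 0 -> exists i : 'I_(p.-1), x == g ^+ i.
  move=> x0; have x1 : x ^+ p.-1 = 1.
    apply: (mulfI x0); rewrite -exprS prednK ?prime_gt0 // mulr1.
    by have := expf_card x; rewrite card_Fp.
  by have [i ->] := prim_rootP gP x1; exists i.
pose e x := if [pick i : 'I_(p.-1) | x == g ^+ i] is Some i then i : nat else 0%N.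
have eP x : x != 0 -> x = g ^+ e x.
  move=> /ex [i xi]; rewrite /e; case: pickP => [j /eqP //| /(_ i)].
  by rewrite xi.
have eq4 i j : g ^+ i = g ^+ j -> i = j %[mod 4].
  move/eqP; rewrite (eq_prim_root_expr gP) => /eqP h.
  by rewrite -(modn_dvdm i d4) h modn_dvdm.
exists e; split.
- move=> x y x0 y0; apply: eq4; rewrite exprD -!eP //.
  by rewrite mulf_neq0.
- by exists g => //; apply: eq4; rewrite -eP ?expr1.
- move=> x x0 /dvdnP [k ek]; exists (g ^+ k); first by rewrite expf_neq0.
  by rewrite -exprM -ek -eP.
Qed.

(** The [j]-th power of the quartic character: [j = 2] gives the quadratic character and [j = 3] the
    inverse one. *)
Definition quartic_char (p : nat) (L : fieldType) (im : L) (e : 'F_p -> nat)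
  (j : nat) (x : 'F_p) : L := if x == 0 then 0 else im ^+ (j * e x).

Lemma quartic_char_mulchar (p : nat) (L : fieldType) (im : L) (e : 'F_p -> nat) (j : nat) :
  quartic_log e -> im ^+ 4 = 1 -> mulchar (quartic_char im e j).
Proof.
move=> [eM _ _] im4.
have imE m n : m = n %[mod 4] -> im ^+ (j * m) = im ^+ (j * n).
  by move=> mn; rewrite -(expr_mod _ im4) -modnMmr mn modnMmr expr_mod.
have cM : {morph quartic_char im e j : x y / x * y}.
  move=> x y; rewrite /quartic_char mulf_eq0.
  case: eqVneq => [|x0]; first by rewrite mul0r.
  case: eqVneq => [|y0]; first by rewrite mulr0.
  by rewrite (imE _ _ (eM _ _ x0 y0)) mulnDr exprD.
split=> //.
have c1 : quartic_char im e j 1 != 0.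
  rewrite /quartic_char oner_eq0 expf_neq0 //.
  by apply/eqP => h; move/eqP: im4; rewrite h expr0n eq_sym oner_eq0.
by apply: (mulfI c1); rewrite -cM !mulr1.
Qed.

(* Real and imaginary parts of [i ^ n]. *)
Definition reI (n : nat) : int := nth 0 [:: 1; 0; -1; 0] (n %% 4).
Definition imI (n : nat) : int := nth 0 [:: 0; 1; 0; -1] (n %% 4).

Lemma expr_reI_imI (L : fieldType) (im : L) (n : nat) : im ^+ 2 = -1 ->
  im ^+ n = (reI n)%:~R + (imI n)%:~R * im /\
  im ^+ (3 * n) = (reI n)%:~R - (imI n)%:~R * im.
Proof.
move=> im2; have im4 : im ^+ 4 = 1 by rewrite (exprM im 2 2) im2 sqrrN expr1n.
rewrite -(expr_mod n im4) -(expr_mod (3 * n) im4) -modnMmr /reI /imI.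
have : (n %% 4 < 4)%N by rewrite ltn_mod.
have im3 : im ^+ 3 = - im by rewrite exprSr im2 mulN1r.
case: (n %% 4)%N => [|[|[|[|//]]]] _; split; rewrite ?[(_ %% _)%N]/= ?im2 ?im3 ?expr0 ?expr1 /=; ring.
Qed.

Definition jacobi_re (p : nat) (e : 'F_p -> nat) : int :=
  \sum_(x : 'F_p | (x != 0) && (1 - x != 0)) reI (e x + e (1 - x)).
Definition jacobi_im (p : nat) (e : 'F_p -> nat) : int :=
  \sum_(x : 'F_p | (x != 0) && (1 - x != 0)) imI (e x + e (1 - x)).

Lemma jacobi_quartic (p : nat) (L : fieldType) (im : L) (e : 'F_p -> nat) :
  im ^+ 2 = -1 ->
  jacobi (quartic_char im e 1) = (jacobi_re e)%:~R + (jacobi_im e)%:~R * im /\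
  jacobi (quartic_char im e 3) = (jacobi_re e)%:~R - (jacobi_im e)%:~R * im.
Proof.
move=> im2.
have H j : jacobi (quartic_char im e j) =
   \sum_(x : 'F_p | (x != 0) && (1 - x != 0)) im ^+ (j * (e x + e (1 - x))).
  rewrite /jacobi [RHS]big_mkcond; apply: eq_bigr => x _; rewrite /quartic_char.
  case: ifP => [/eqP -> | x0]; first by rewrite mul0r.
  case: ifP => [/eqP -> | x1]; first by rewrite mulr0.
  by rewrite -exprD mulnDr.
split; rewrite H /jacobi_re /jacobi_im !rmorph_sum mulr_suml.
- rewrite -big_split; apply: eq_bigr => x _.
  by rewrite mul1n; case: (expr_reI_imI (e x + e (1 - x)) im2).
- rewrite -sumrB; apply: eq_bigr => x _.
  by case: (expr_reI_imI (e x + e (1 - x)) im2).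
Qed.

(** With the quadratic Gauss sum [G2] one has [G ^+ 2 = J * G2], [G' ^+ 2 = J' * G2] and
    [G2 ^+ 2 = p%:R]; squaring [G * G'] then yields [J * J' = p%:R]. The conditions on [im] and on
    [-1] make the three characters nontrivial. *)
Lemma quartic_gauss (p : nat) (L : fieldType) (z im : L) (e : 'F_p -> nat) :
  prime p -> (p %% 4)%N = 1%N -> quartic_log e -> p%:R != 0 :> L -> im != 1 -> 1 != - 1 :> L ->
  p.-primitive_root z -> im ^+ 2 = -1 ->
  let J := (jacobi_re e)%:~R + (jacobi_im e)%:~R * im in
  let J' := (jacobi_re e)%:~R - (jacobi_im e)%:~R * im in
  let G := gauss z (quartic_char im e 1) in
  let G' := gauss z (quartic_char im e 3) in
  [/\ G ^+ 4 = J ^+ 3 * J',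
      G * G' = quartic_char im e 1 (-1) * p%:R & J * J' = p%:R].
Proof.
move=> pp p4 He pL im1 L2 pz im2 J J' G G'.
have [eM [g g0 eg] eK] := He.
have im4 : im ^+ 4 = 1 by rewrite (exprM im 2 2) im2 sqrrN expr1n.
have mc j := quartic_char_mulchar j He im4.
have cg j : quartic_char im e j g = im ^+ j.
  rewrite /quartic_char (negPf g0) -(expr_mod _ im4) -modnMmr eg modnMmr muln1.
  by rewrite expr_mod.
have imN1 : im ^+ 3 != 1.
  rewrite (_ : 3 = 2 + 1)%N // exprD im2 expr1 mulN1r.
  by apply: contra im1 => /eqP h; move: im2; rewrite -[im]opprK h sqrrN expr1n => /eqP; rewrite (negPf L2).
have s1 := mulchar_sum0 (mc 1%N) g0; rewrite cg expr1 in s1.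
have s2 := mulchar_sum0 (mc 2%N) g0; rewrite cg im2 eq_sym in s2.
have s3 := mulchar_sum0 (mc 3%N) g0; rewrite cg in s3.
have sqE i j : (2 * i = j %[mod 4])%N -> forall x, quartic_char im e j x = quartic_char im e i x ^+ 2.
  move=> ij x; rewrite /quartic_char; case: eqP => _; first by rewrite expr0n.
  rewrite -exprM mulnAC -[RHS](expr_mod _ im4) -modnMml [(i * 2)%N]mulnC ij modnMml.
  by rewrite expr_mod.
have GG' : G * G' = quartic_char im e 1 (-1) * p%:R.
  apply: gauss_mul_inv => //; last exact: s1.
  move=> x x0; rewrite /quartic_char (negPf x0) -exprD -mulnDl.
  by rewrite exprM im4 expr1n.
have [Je J'e] := jacobi_quartic e im2.
pose G2 := gauss z (quartic_char im e 2).
have g1 : G ^+ 2 = J * G2.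
  by rewrite /J -Je; apply: gauss_sqr => //; [exact: sqE | exact: s2].
have g3 : G' ^+ 2 = J' * G2.
  by rewrite /J' -J'e; apply: gauss_sqr => //; [exact: sqE | exact: s2].
have c2N1 : quartic_char im e 2 (-1) = 1.
  have [_ c11 cM] := mc 1%N.
  by rewrite (sqE 1%N 2%N) // expr2 -cM mulrNN mulr1.
have g2 : G2 ^+ 2 = p%:R.
  rewrite expr2 /G2; transitivity (quartic_char im e 2 (-1) * p%:R); last by rewrite c2N1 mul1r.
  apply: gauss_mul_inv => //; last exact: s2.
  move=> x x0; rewrite /quartic_char (negPf x0) -exprD -mulnDl.
  by rewrite exprM im4 expr1n.
have JJ' : J * J' = p%:R.
  apply: (mulIf pL); rewrite -{1}g2 -expr2.
  have [_ c11 cM] := mc 1%N.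
  have <- : (G * G') ^+ 2 = p%:R ^+ 2.
    rewrite GG' exprMn [_ (-1) ^+ 2]expr2 -cM mulrNN mulr1.
    by rewrite c11 mul1r.
  by rewrite exprMn g1 g3; ring.
split=> //.
by rewrite (exprM G 2 2) g1 exprMn g2 -JJ'; ring.
Qed.

(** In [algC], with [im = 'i], the relation [J * J' = p%:R] becomes an identity of integers. *)
Lemma jacobi_norm (p : nat) (e : 'F_p -> nat) :
  prime p -> (p %% 4)%N = 1%N -> quartic_log e ->
  jacobi_re e ^+ 2 + jacobi_im e ^+ 2 = p%:Z.
Proof.
move=> pp p4 He; have [z pz] := C_prim_root_exists (prime_gt0 pp).
have L2 : 1 != -1 :> algC.
  by rewrite -subr_eq0 opprK -(natrD _ 1 1) Num.Theory.pnatr_eq0.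
have i1 : 'i != 1 :> algC.
  apply/eqP => h; have := Num.Theory.sqrCi algC; rewrite h expr1n => /eqP.
  by rewrite (negPf L2).
have pL : p%:R != 0 :> algC by rewrite Num.Theory.pnatr_eq0 -lt0n prime_gt0.
have [_ _ JJ'] := quartic_gauss pp p4 He pL i1 L2 pz (Num.Theory.sqrCi algC).
apply/eqP; rewrite -(eqr_int algC); apply/eqP; rewrite rmorphD !rmorphXn /= -[RHS]JJ'.
by rewrite mulrC -subr_sqr exprMn Num.Theory.sqrCi; ring.
Qed.

(** * Reciprocity by Frobenius in characteristic [q] *)

(** By Euler's theorem [n] divides the order of the unit group of the field with [q ^ totient n]
    elements. *)
Lemma finField_prim_root (q n : nat) : prime q -> coprime q n -> (0 < n)%N ->
  exists K : finFieldType, q \in [pchar K] /\ exists t : K, n.-primitive_root t.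
Proof.
move=> pq qn n0; have t0 : (0 < totient n)%N by rewrite totient_gt0.
have [K chK cK] := pPrimePowerField pq t0; exists K; split=> //.
have dn : (n %| (q ^ totient n).-1)%N.
  by rewrite -subn1 -eqn_mod_dvd ?expn_gt0 ?prime_gt0 // Euler_exp_totient.
have [g gP] := finField_generator K; rewrite cK in gP.
by exists (g ^+ ((q ^ totient n).-1 %/ n)); apply: dvdn_prim_root.
Qed.

(* [Im ((a + b i) (u - i)^4)] *)
Definition quartic_form (a b u : int) : int :=
  b * (u ^+ 4 - 6 * u ^+ 2 + 1) - 4 * a * (u ^+ 3 - u).

Lemma quartic_char_eq1 (L : fieldType) (im : L) (n : nat) :
  im ^+ 2 = -1 -> im != 1 -> 1 != -1 :> L -> im ^+ n = 1 -> (4 %| n)%N.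
Proof.
move=> im2 im1 L2; have im4 : im ^+ 4 = 1 by rewrite (exprM im 2 2) im2 sqrrN expr1n.
rewrite -(expr_mod n im4) /dvdn.
have : (n %% 4 < 4)%N by rewrite ltn_mod.
case: (n %% 4)%N => [|[|[|[|//]]]] _ //; rewrite ?expr1 ?im2 => /eqP.
- by rewrite (negPf im1).
- by rewrite eq_sym (negPf L2).
- rewrite exprSr im2 mulN1r => /eqP h.
  by move: im2; rewrite -[im]opprK h sqrrN expr1n => /eqP; rewrite (negPf L2).
Qed.

(** Frobenius turns [z] into [z ^+ q], and dilating the sum by [q] undoes this at the cost of the
    factor [chi' q%:R]. *)
Lemma Fp_gauss_frobenius (p q : nat) (K : fieldType) (z : K) (chi chi' : 'F_p -> K) :
  prime p -> z ^+ p = 1 -> q \in [pchar K] -> mulchar chi' -> (q%:R != 0 :> 'F_p) ->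
  (forall x, chi x ^+ q = chi' x) ->
  chi' q%:R * gauss z chi ^+ q = gauss z chi'.
Proof.
move=> pp zp chK mc q0 h; rewrite -(gauss_dilate z mc q0); congr (_ * _).
rewrite /gauss -(pFrobenius_autE chK) rmorph_sum; apply: eq_bigr => x _.
rewrite [LHS]exprMn h; congr (_ * _).
rewrite -exprM -(expr_Fp_nat (x * q) pp zp).
by congr (z ^+ nat_of_ord _); rewrite natrM mulrC natr_Zp.
Qed.

Lemma odd_mod4 (n : nat) : odd n -> (n %% 4 = 1 \/ n %% 4 = 3)%N.
Proof. lia. Qed.

Lemma quartic_reciprocity (p q : nat) (e : 'F_p -> nat) (u : int) :
  prime p -> (p %% 4)%N = 1%N -> quartic_log e -> prime q -> odd q -> q != p ->
  (q%:Z %| quartic_form (jacobi_re e) (jacobi_im e) u)%Z ->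
  exists2 y : 'F_p, y != 0 & (if (q %% 4)%N == 1%N then q%:R else - q%:R) = y ^+ 4.
Proof.
move=> pp p4 He pq oq qp qdvd.
have cq : coprime q (4 * p).
  rewrite coprimeMr (coprimeXr 2 (_ : coprime q 2)) /=; last by rewrite coprimen2.
  by rewrite prime_coprime // dvdn_prime2.
have p40 : (0 < 4 * p)%N by rewrite muln_gt0 (prime_gt0 pp).
have [K [chK [t tP]]] := finField_prim_root pq cq p40.
pose z := t ^+ ((4 * p) %/ p); pose im := t ^+ ((4 * p) %/ 4).
have pz : p.-primitive_root z by apply: dvdn_prim_root tP _ (dvdn_mull _ _).
have pim : 4.-primitive_root im by apply: dvdn_prim_root tP _ (dvdn_mulr _ _).
have natK (n : nat) : (n%:R == 0 :> K) = (q %| n)%N by rewrite (dvdn_pcharf chK).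
have L2 : 1 != -1 :> K.
  by rewrite -subr_eq0 opprK -(natrD _ 1 1) (natK 2) dvdn_prime2 //; apply: contraTneq oq => ->.
have im1 : im != 1 by rewrite -(expr0 im) -{1}(expr1 im) (eq_prim_root_expr pim).
have im2 : im ^+ 2 = -1.
  have : (im ^+ 2 - 1) * (im ^+ 2 + 1) = 0.
    by rewrite -subr_sqr -exprM (prim_expr_order pim) expr1n subrr.
  move/eqP; rewrite mulf_eq0 subr_eq0 addr_eq0 => /orP [|/eqP //].
  by rewrite -(expr0 im) (eq_prim_root_expr pim).
have im4 := prim_expr_order pim.
have pK : p%:R != 0 :> K by rewrite natK dvdn_prime2.
have := quartic_gauss pp p4 He pK im1 L2 pz im2.
have JN := jacobi_norm pp p4 He.
move: qdvd JN; set a := jacobi_re e; set b := jacobi_im e => qdvd JN.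
set J := a%:~R + b%:~R * im; set J' := a%:~R - b%:~R * im.
set G := gauss z _; set G' := gauss z _ => /= [] [G4 GG' JJ'].
have fK : b%:~R * (u%:~R ^+ 4 - 6 * u%:~R ^+ 2 + 1) - 4 * a%:~R * (u%:~R ^+ 3 - u%:~R) = 0 :> K.
  have /dvdzP [k fk] := qdvd.
  transitivity ((quartic_form a b u)%:~R : K); first by rewrite /quartic_form; ring.
  have /eqP qK : q%:R == 0 :> K by rewrite natK.
  by rewrite fk rmorphM /= -pmulrn qK mulr0.
pose w1 : K := u%:~R + im; pose w2 : K := u%:~R - im.
(* If [u ^+ 2 = -1] in [K], the form reduces to [8 * (b + a * u)]. Its vanishing gives
   [b = - (a * u)], so that [p = a ^+ 2 * (u ^+ 2 + 1) = 0] in [K]. *)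
have w12 : w1 * w2 != 0.
  have -> : w1 * w2 = u%:~R ^+ 2 + 1 by rewrite mulrC -subr_sqr im2 opprK.
  apply/eqP => u0.
  have n8 : 8%:R != 0 :> K.
    rewrite natK (_ : 8 = 2 ^ 3)%N // Euclid_dvdX // dvdn_prime2 // andbT.
    by apply: contraTneq oq => ->.
  have bau : b%:~R = - (a%:~R * u%:~R) :> K.
    apply: (mulfI n8); apply/eqP; rewrite -subr_eq0; apply/eqP; rewrite -[RHS]fK.
    have -> : u%:~R ^+ 4 = 1 :> K.
      have -> : u%:~R ^+ 4 = (u%:~R ^+ 2 + 1) * (u%:~R ^+ 2 - 1) + 1 :> K by ring.
      by rewrite u0 mul0r add0r.
    have -> : u%:~R ^+ 3 = (u%:~R ^+ 2 + 1) * u%:~R - u%:~R :> K by ring.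
    have -> : u%:~R ^+ 2 = -1 :> K by apply/eqP; rewrite -addr_eq0 u0.
    by ring.
  have : (a ^+ 2 + b ^+ 2)%:~R = 0 :> K.
    rewrite rmorphD !rmorphXn /= bau.
    transitivity (a%:~R ^+ 2 * (u%:~R ^+ 2 + 1) : K); first by ring.
    by rewrite u0 mulr0.
  by rewrite JN => /eqP; rewrite -pmulrn (negPf pK).
have /norP [w10 w20] : ~~ ((w1 == 0) || (w2 == 0)) by rewrite -mulf_eq0.
pose w := w2 / w1.
have w0 : w != 0 by rewrite mulf_neq0 ?invr_neq0.
have J'w : J' = J * w ^+ 4.
  rewrite /w expr_div_n mulrA; apply: (canRL (mulfK _)); first by rewrite expf_neq0.
  apply/eqP; rewrite -subr_eq0; apply/eqP.
  (* The explicit multiple of [im ^+ 2 + 1] makes this a polynomial identity in [im], which [ring]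
     can check without knowing [im ^+ 2 = -1]. *)
  transitivity (- 2 * im *
      (b%:~R * (u%:~R ^+ 4 - 6 * u%:~R ^+ 2 + 1) - 4 * a%:~R * (u%:~R ^+ 3 - u%:~R)) +
      (im ^+ 2 + 1) *
      (im * (8 * a%:~R * u%:~R - 12 * b%:~R * u%:~R ^+ 2 - 2 * b%:~R * (im ^+ 2 - 1)))).
    by rewrite /J' /J /w1 /w2; ring.
  by rewrite fK im2 addNr mulr0 mul0r addr0.
have G4w : G ^+ 4 = (J * w) ^+ 4 by rewrite G4 J'w; ring.
have G0 : G != 0.
  have := pK; rewrite -JJ' mulf_eq0 => /norP [J0 J'0].
  have : G ^+ 4 != 0 by rewrite G4 mulf_neq0 // expf_neq0.
  by apply: contra => /eqP ->; rewrite expr0n.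
have mc j := quartic_char_mulchar j He im4.
have q0 : q%:R != 0 :> 'F_p.
  by rewrite -(dvdn_pcharf (pchar_Fp pp)) dvdn_prime2 // eq_sym.
have [_ _ eK] := He.
have intq (n : int) : (n%:~R : K) ^+ q = n%:~R.
  by rewrite -(pFrobenius_autE chK) rmorph_int.
have frobD (x y : K) : (x + y) ^+ q = x ^+ q + y ^+ q.
  by rewrite -(pFrobenius_autE chK) rmorphD.
have frobB (x y : K) : (x - y) ^+ q = x ^+ q - y ^+ q.
  by rewrite -(pFrobenius_autE chK) rmorphB.
have charq (x : 'F_p) : quartic_char im e 1 x ^+ q = quartic_char im e (q %% 4) x.
  rewrite /quartic_char; case: eqP => _.
    by rewrite expr0n; case: (q) (prime_gt0 pq).
  by rewrite -exprM mul1n mulnC -(expr_mod _ im4) -modnMml expr_mod.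
have := @Fp_gauss_frobenius p q K z _ _ pp (prim_expr_order pz) chK (mc (q %% 4)%N) q0 charq.
rewrite -/G.
(* For [q] congruent to 1 modulo 4, Frobenius fixes [J * w], so [(J * w) ^+ q.-1 = 1]. As
   [G ^+ 4 = (J * w) ^+ 4], also [G ^+ q = G], and the character is 1 at [q]. *)
case: (odd_mod4 oq) => q4; rewrite q4 /=.
  have imq : im ^+ q = im by rewrite -(expr_mod q im4) q4 expr1.
  have Jq : J ^+ q = J by rewrite /J frobD exprMn !intq imq.
  have wq : w ^+ q = w by rewrite /w expr_div_n /w1 /w2 frobB frobD !intq imq.
  have q1 : (q = (4 * (q %/ 4)).+1)%N by rewrite {1}(divn_eq q 4) q4 addn1 mulnC.
  have Gq : G ^+ q = G.
    rewrite q1 exprS exprM G4w -exprM.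
    have Jw0 : J * w != 0 by apply: contraNneq G0 => h; move/eqP: G4w; rewrite h expr0n expf_eq0.
    suff -> : (J * w) ^+ (4 * (q %/ 4)) = 1 by rewrite mulr1.
    by apply: (mulfI Jw0); rewrite -exprS -q1 exprMn Jq wq mulr1.
  rewrite -/G Gq -[RHS]mul1r => /(mulIf G0).
  rewrite /quartic_char (negPf q0) mul1n => h.
  by apply: eK => //; apply: quartic_char_eq1 h.
(* For [q] congruent to 3 modulo 4, Frobenius sends [J] to [J'] and [w] to its inverse, so [G ^+
   q.+1 = (J * w) ^+ q.+1 = J * J' = p%:R], to be compared with [G * G']. *)
rewrite -/G' => h.
have imq : im ^+ q = - im by rewrite -(expr_mod q im4) q4 exprSr im2 mulN1r.
have Jq : J ^+ q = J' by rewrite /J frobD exprMn !intq imq mulrN.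
have wq : w ^+ q = w^-1 by rewrite /w expr_div_n /w1 /w2 frobB frobD !intq imq opprK invf_div.
have q1 : (q.+1 = 4 * (q %/ 4).+1)%N by rewrite {1}(divn_eq q 4) q4 -addnS [RHS]mulnS [RHS]addnC mulnC.
have Gq : G ^+ q * G = p%:R.
  rewrite -exprSr q1 exprM G4w -exprM -q1 exprSr exprMn Jq wq -JJ'.
  by rewrite mulrACA mulVf // mulr1 mulrC.
have : quartic_char im e 3 q%:R = quartic_char im e 1 (-1).
  apply: (mulIf pK); rewrite -GG' -[in LHS]Gq mulrA h; exact: mulrC.
(* The cube of the character at [q] equals its value at [-1]; multiplying by its value at [q] shows
   that it is 1 at [-q]. *)
move/(congr1 (fun x => x * quartic_char im e 1 q%:R)).
have [_ _ cM] := mc 1%N.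
rewrite -cM mulN1r {1 2}/quartic_char (negPf q0) -exprD -mulnDl exprM im4 expr1n.
rewrite /quartic_char oppr_eq0 (negPf q0) mul1n => /esym hh.
by apply: eK; rewrite ?oppr_eq0 //; apply: quartic_char_eq1 hh.
Qed.

End QuarticReciprocity.

(** * Products of integers with few prime factors *)

Section SmoothProducts.
Import all_boot zify.
Local Set Implicit Arguments.
Local Unset Strict Implicit.
Local Open Scope nat_scope.

Lemma prod_pfactor_dvd (s : seq nat) (n : nat) :
  uniq s -> all prime s -> 0 < n -> \prod_(q <- s) q ^ logn q n %| n.
Proof.
move=> us ps n0; elim: s us ps => [|q s IH] /=; first by rewrite big_nil dvd1n.
case/andP => qs us /andP [pq ps]; rewrite big_cons Gauss_dvd; last first.
  elim: s qs us ps {IH} => [|r s IH] /=; first by rewrite big_nil coprimen1.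
  rewrite inE negb_or => /andP [qr qs] /andP [_ us] /andP [pr ps].
  rewrite big_cons coprimeMr IH // andbT.
  by rewrite coprimeXl // coprimeXr // prime_coprime // dvdn_prime2.
by rewrite pfactor_dvdnn IH.
Qed.

(* The summand [T %/ q ^ L] is there for the induction. *)
Lemma sum_div_expn (q T L : nat) : 0 < q ->
  q.-1 * (\sum_(1 <= k < L.+1) T %/ q ^ k) + T %/ q ^ L <= T.
Proof.
move=> q0; elim: L => [|L IH]; first by rewrite big_geq // muln0 divn1.
rewrite big_nat_recr //= mulnDr -addnA -mulSnr prednK //.
apply: leq_trans IH; rewrite leq_add2l expnSr divnMA mulnC.
exact: leq_trunc_div.
Qed.

(** The cutoff [L] is free, so that one [L] serves many [n] and the sums over [k] and [n] can be
    exchanged. *)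
Lemma logn_sum (q n L : nat) : prime q -> 0 < n -> logn q n <= L ->
  logn q n = \sum_(1 <= k < L.+1) (q ^ k %| n).
Proof.
move=> pq n0; set v := logn q n => vL.
have -> : \sum_(1 <= k < L.+1) (q ^ k %| n) = \sum_(1 <= k < L.+1) (k <= v).
  by apply: eq_bigr => k _; rewrite pfactor_dvdn.
have H K : \sum_(1 <= k < K.+1) (k <= v) = minn K v.
  elim: K => [|K IH]; first by rewrite big_geq // min0n.
  rewrite big_nat_recr //= IH; case: leqP; lia.
by rewrite H; apply/esym/minn_idPr.
Qed.

Lemma logn_fact_ge (q N : nat) : prime q -> N %/ q <= logn q N`!.
Proof.
move=> pq; rewrite logn_fact //; case: N => [|N]; first by rewrite div0n.
by rewrite big_nat_recl // expn1 leq_addr.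
Qed.

Lemma fact_leq_expn (N : nat) : N`! <= N ^ N.
Proof.
case: N => // N; rewrite fact_prod.
rewrite -[X in _ <= _ ^ X](_ : \sum_(1 <= i < N.+2) 1 = _); last first.
  by rewrite sum_nat_const_nat subSS subn0 muln1.
rewrite expn_sum big_nat_cond [X in _ <= X]big_nat_cond.
by apply: leq_prod => i /andP [/andP [_ h] _]; rewrite expn1.
Qed.

Section CountBound.
(** [g t] stands for the absolute value of the form at the [t]-th argument and [S] for a list
    containing the available primes. The factor [N] of [T] separates small primes, which are
    compared with the factorial of [N], from large ones. *)
Variables (g : nat -> nat) (p T M N X : nat) (S : seq nat).
Hypotheses (T_eq : T = N * M) (N0 : 0 < N).
Hypothesis g_pos : forall t, T <= t < T + T -> 0 < g t <= X.
Hypothesis g_16 : forall t, T <= t < T + T -> ~~ (16 %| g t).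
Hypothesis g_count : forall q j, prime q -> odd q -> q != p -> 0 < j ->
  count (fun t => q ^ j %| g t) (iota T T) <= 4 * (T %/ q ^ j).+1.
Hypothesis g_S : forall q t, T <= t < T + T -> prime q -> odd q -> q != p ->
  q %| g t -> q \in S.

(** Values divisible by [p] are dropped, as reciprocity says nothing about [q = p]. *)
Let G := [seq t <- iota T T | ~~ (p %| g t)].
Let P := \prod_(t <- G) g t.

Let G_range t : t \in G -> T <= t < T + T.
Proof. by rewrite mem_filter mem_iota => /andP []. Qed.

Let P_pos : 0 < P.
Proof.
by rewrite /P big_seq; apply: prodn_cond_gt0 => t /G_range /g_pos /andP [].
Qed.

Let logn_P q : prime q -> logn q P = \sum_(t <- G) logn q (g t).
Proof.
move=> pq; rewrite /P; move: G_range; elim: G => [|t s IH] H.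
  by rewrite !big_nil logn1.
have gt0 : 0 < g t by have /g_pos /andP [] := H t (mem_head _ _).
have sr u : u \in s -> T <= u < T + T by move=> us; apply: H; rewrite inE us orbT.
rewrite !big_cons lognM ?IH // big_seq.
by apply: prodn_cond_gt0 => u /sr /g_pos /andP [].
Qed.

(** The exponent is the sum over [k <= L] of the number of [t] with [q ^ k] dividing [g t], each at
    most [4 * (T %/ q ^ k).+1]. The quotients are bounded by a geometric series. *)
Let logn_P_odd q : prime q -> odd q -> q != p ->
  exists L, q ^ L <= X.+1 /\ logn q P <= 4 * (T %/ q.-1) + 4 * L.
Proof.
move=> pq oq qp; pose L := trunc_log q X.+1; exists L; split.
  by apply: trunc_logP => //; apply: prime_gt1.
rewrite logn_P //.
have -> : \sum_(t <- G) logn q (g t) = \sum_(t <- G) \sum_(1 <= k < L.+1) (q ^ k %| g t).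
  apply: eq_big_seq => t /G_range /g_pos /andP [gt0 gX]; apply: logn_sum => //.
  rewrite /L -[logn q _](@trunc_expnK q) ?prime_gt1 //.
  apply: leq_trunc_log; apply: leq_trans (leqW gX).
  by apply: dvdn_leq => //; rewrite pfactor_dvdnn.
rewrite exchange_big /=.
apply: leq_trans (_ : \sum_(1 <= k < L.+1) 4 * (T %/ q ^ k).+1 <= _).
  rewrite big_nat_cond [X in _ <= X]big_nat_cond.
  apply: leq_sum => k /andP [/andP [k0 _] _].
  apply: leq_trans (g_count pq oq qp k0); rewrite -sum1_count /G big_filter.
  rewrite big_mkcond [X in _ <= X]big_mkcond.
  by apply: leq_sum => t _; case: (p %| _); case: (_ %| _).
rewrite -big_distrr /= -mulnDr leq_mul2l /=.
under eq_bigr do rewrite -addn1.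
rewrite big_split /= sum_nat_const_nat subSS subn0 muln1 leq_add2r.
rewrite leq_divRL; last by have := prime_gt1 pq; case: (q) => [|[|]].
rewrite mulnC; apply: leq_trans (@sum_div_expn q T L (prime_gt0 pq)).
exact: leq_addr.
Qed.

Let dvd_P q : prime q -> q %| P -> exists2 t, t \in G & q %| g t.
Proof.
move=> pq; rewrite /P; elim: G => [|t s IH].
  by rewrite big_nil Euclid_dvd1.
rewrite big_cons Euclid_dvdM // => /orP [qt | /IH [u us qu]].
  by exists t; rewrite ?mem_head.
by exists u; rewrite // inE us orbT.
Qed.

(** [N %/ q] is a lower bound for the exponent of [q] in the factorial of [N]. The constant 3 comes
    from [N <= 2 * q * (N %/ q)] and [2 * q <= 3 * q.-1]. *)
Let div_le q : 2 < q -> q <= N -> T %/ q.-1 <= 3 * M * (N %/ q).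
Proof.
move=> q2 qN; have q10 : 0 < q.-1 by lia.
rewrite -[leqRHS](@mulnK _ q.-1) //; apply: leq_div2r.
- have h : N <= 2 * q * (N %/ q).
    have d0 : 0 < N %/ q by rewrite divn_gt0 //; lia.
    have := ltn_ceil N (ltnW (ltnW q2)); nia.
  rewrite T_eq; apply: leq_trans (_ : 2 * q * (N %/ q) * M <= _).
    by rewrite leq_mul2r h orbT.
  have : 2 * q <= 3 * q.-1 by lia.
  by move: (N %/ q) => d; nia.
Qed.

(** For [q <= N] the exponent [4 * (T %/ q.-1)] is absorbed by the [q]-part of the factorial of [N].
    For [q > N] that quotient is at most [M], and [q <= X.+1] suffices. *)
Let pfactor_P q : prime q -> odd q -> q != p ->
  q ^ logn q P <= X.+1 ^ (4 * M.+1) * (q ^ logn q N`!) ^ (12 * M).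
Proof.
move=> pq oq qp; have q1 := prime_gt1 pq; have q0 := prime_gt0 pq.
have [/eqP -> | qP] := boolP (logn q P == 0).
  by rewrite muln_gt0 !expn_gt0 q0.
have qX : q <= X.+1.
  have /(dvd_P pq) [t /G_range /g_pos /andP [g0 gX] qt] : q %| P.
    by move: qP; rewrite -lt0n logn_gt0 mem_primes => /and3P [].
  exact: leq_trans (dvdn_leq g0 qt) (leqW gX).
have [L [qL le]] := logn_P_odd pq oq qp.
apply: leq_trans (_ : q ^ (4 * (T %/ q.-1) + 4 * L) <= _); first by rewrite leq_exp2l.
have q4 : q ^ (4 * L) <= X.+1 ^ 4 by rewrite mulnC expnM leq_exp2r.
rewrite expnD; case: (leqP q N) => qN.
  rewrite mulnC; apply: leq_mul.
    by apply: leq_trans q4 _; rewrite leq_pexp2l //; lia.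
  rewrite -expnM leq_exp2l //.
  have q2 : 2 < q by move: q1 oq; case: (q) => [|[|[|]]].
  have := leq_trans (div_le q2 qN) (leq_mul (leqnn (3 * M)) (logn_fact_ge N pq)).
  by rewrite -(@leq_pmul2l 4) // mulnA [12 * M]mulnC (mulnC _ (M * 12)) (_ : 12 = 4 * 3) // [M * _]mulnC !mulnA.
rewrite -[leqLHS]muln1; apply: leq_mul; last by rewrite !expn_gt0 q0.
rewrite mulnS expnD mulnC; apply: leq_mul => //.
apply: leq_trans (_ : q ^ (4 * M) <= _); last first.
  by case: (posnP M) => [-> //|M0]; rewrite leq_exp2r // muln_gt0.
rewrite leq_exp2l // leq_mul2l /=; apply: leq_trans (_ : T %/ N <= _).
  by apply: leq_div2l => //; lia.
by rewrite T_eq mulKn.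
Qed.

Let P_p : ~~ (p %| P) || ~~ prime p.
Proof.
case: (boolP (prime p)) => [pp|]; last by rewrite orbT.
rewrite orbF; apply/negP => /(dvd_P pp) [t].
by rewrite mem_filter => /andP [/negP].
Qed.

Let logn2_P : logn 2 P <= 3 * T.
Proof.
rewrite logn_P //; apply: leq_trans (_ : \sum_(t <- G) 3 <= _).
  rewrite big_seq [leqRHS]big_seq; apply: leq_sum => t tG.
  have /g_pos /andP [gt0 _] := G_range tG.
  rewrite leqNgt -(pfactor_dvdn 4) //; exact: g_16 (G_range tG).
rewrite big_const_seq iter_addn_0 leq_mul2l /= count_predT.
by rewrite size_filter (leq_trans (count_size _ _)) // size_iota.
Qed.

(** The factors account for the power of 2, with exponent at most 3 in each value; for
    [X.+1 ^ (4 * M.+1)] from each prime in [S]; and for the [q]-parts of the factorial of [N], whose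
    product divides that factorial and is at most [N ^ N]. *)
Lemma prod_smooth_bound :
  P <= 8 ^ T * X.+1 ^ (4 * M.+1 * size S) * N ^ (12 * T).
Proof.
pose W := [seq q <- primes P | q != 2].
have uW : uniq W by rewrite filter_uniq // primes_uniq.
have WP q : q \in W -> [/\ prime q, odd q, q != p & q \in S].
  rewrite mem_filter mem_primes => /andP [q2 /and3P [pq _ qP]].
  have oq : odd q by case: (even_prime pq) q2 => // ->.
  have qp : q != p.
    by apply: contraTneq qP => qp; move: P_p; rewrite -qp pq orbF.
  split=> //; have [t /G_range tG qt] := dvd_P pq qP.
  exact: g_S tG pq oq qp qt.
have -> : P = 2 ^ logn 2 P * \prod_(q <- W) q ^ logn q P.
  rewrite {1}(prod_prime_decomp P_pos) prime_decompE big_map /W big_filter.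
  case: (boolP (2 \in primes P)) => h2.
    by rewrite (bigD1_seq 2) ?primes_uniq.
  have -> : logn 2 P = 0 by apply/eqP; rewrite -leqn0 leqNgt logn_gt0.
  rewrite mul1n [RHS]big_seq_cond big_seq; apply: eq_bigl => q.
  by case: eqP => [->|]; rewrite ?(negPf h2) ?andbT.
rewrite -mulnA; apply: leq_mul.
  by rewrite (_ : 8 = 2 ^ 3) // -expnM leq_exp2l ?logn2_P.
apply: leq_trans (_ : \prod_(q <- W) (X.+1 ^ (4 * M.+1) * (q ^ logn q N`!) ^ (12 * M)) <= _).
  rewrite big_seq [leqRHS]big_seq; apply: leq_prod => q /WP [pq oq qp _].
  exact: pfactor_P.
rewrite big_split /=; apply: leq_mul.
  rewrite big_const_seq count_predT iter_muln_1 -expnM leq_pexp2l //.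
  by rewrite leq_mul2l (uniq_leq_size uW) ?orbT // => q /WP [].
have -> : \prod_(q <- W) (q ^ logn q N`!) ^ (12 * M) =
    (\prod_(q <- W) q ^ logn q N`!) ^ (12 * M).
  by rewrite (big_morph (fun n => n ^ _) (fun a b => expnMn a b _) (exp1n _)).
apply: leq_trans (_ : (N ^ N) ^ (12 * M) <= _).
  case: (posnP M) => [-> // | M0].
  rewrite leq_exp2r ?muln_gt0 //; apply: leq_trans (fact_leq_expn N).
  apply: dvdn_leq; rewrite ?fact_gt0 //; apply: prod_pfactor_dvd => //; last exact: fact_gt0.
  by apply/allP => q /WP [].
by rewrite -expnM T_eq mulnCA.
Qed.
End CountBound.

End SmoothProducts.

(** * The quartic form *)

Section QuarticForm.
Import all_boot all_order all_algebra ring zify.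
Import Order.TTheory GRing.Theory Num.Theory.
Local Set Implicit Arguments.
Local Unset Strict Implicit.
Local Open Scope ring_scope.

(** * Simplicity and number of the roots modulo [q] *)

Lemma Euclid_dvdz (q : nat) (x y : int) : prime q ->
  (q%:Z %| x * y)%Z = (q%:Z %| x)%Z || (q%:Z %| y)%Z.
Proof. by move=> pq; rewrite !dvdzE abszM Euclid_dvdM. Qed.

Lemma dvdz_odd_prime (q k : nat) : prime q -> odd q -> ~~ (q%:Z %| 2 ^+ k)%Z.
Proof.
move=> pq oq; rewrite dvdzE abszX /= Euclid_dvdX // negb_and dvdn_prime2 //.
by apply/orP; left; apply: contraTneq oq => ->.
Qed.

Definition quartic_deriv (a b u : int) : int :=
  b * (4 * u ^+ 3 - 12 * u) - 4 * a * (3 * u ^+ 2 - 1).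

Lemma quartic_deriv_ndvd (p q : nat) (a b u : int) :
  prime p -> a ^+ 2 + b ^+ 2 = p%:Z -> prime q -> odd q -> q != p ->
  (q%:Z %| quartic_form a b u)%Z -> ~~ (q%:Z %| quartic_deriv a b u)%Z.
Proof.
move=> pp abp pq oq qp qF; apply/negP => qF'.
have nqp : ~~ (q%:Z %| p%:Z)%Z by rewrite dvdzE /= dvdn_prime2.
(* With [x + i y = (a + b i) (u - i)^3] the form is [y u - x], its derivative
   is [4 y], and [x^2 + y^2 = p (u^2 + 1)^3]. *)
pose y := b * (u ^+ 3 - 3 * u) - a * (3 * u ^+ 2 - 1).
have qy : (q%:Z %| y)%Z.
  have : (q%:Z %| 2 ^+ 2 * y)%Z by rewrite (_ : _ * y = quartic_deriv a b u) // /y /quartic_deriv; ring.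
  by rewrite Euclid_dvdz // (negPf (dvdz_odd_prime 2 pq oq)).
have qu : (q%:Z %| u ^+ 2 + 1)%Z.
  have : (q%:Z %| p%:Z * (u ^+ 2 + 1) ^+ 3)%Z.
    rewrite -abp.
    have -> : (a ^+ 2 + b ^+ 2) * (u ^+ 2 + 1) ^+ 3 =
      (y * u - quartic_form a b u) ^+ 2 + y ^+ 2 by rewrite /y /quartic_form; ring.
    by apply: rpredD; rewrite expr2 dvdz_mulr // rpredB // dvdz_mulr.
  by rewrite Euclid_dvdz // (negPf nqp) /= !dvdzE abszX Euclid_dvdX // andbT.
(* Modulo [u ^+ 2 + 1] the form is [8 * (b + a * u)], and [(b + a * u) * (b - a * u)] is
   [a ^+ 2 + b ^+ 2 = p]; so [q] would divide [p]. *)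
have qab : (q%:Z %| b + a * u)%Z.
  have : (q%:Z %| 2 ^+ 3 * (b + a * u))%Z.
    have -> : 2 ^+ 3 * (b + a * u) = quartic_form a b u -
       (u ^+ 2 + 1) * (b * (u ^+ 2 - 7) - 4 * a * u) by rewrite /quartic_form; ring.
    by rewrite rpredB // dvdz_mulr.
  by rewrite Euclid_dvdz // (negPf (dvdz_odd_prime 3 pq oq)).
move/negP: nqp; apply; rewrite -abp.
have -> : a ^+ 2 + b ^+ 2 = (b + a * u) * (b - a * u) + (u ^+ 2 + 1) * a ^+ 2 by ring.
by rewrite rpredD // dvdz_mulr.
Qed.

(** Uniqueness in Hensel's lemma: the difference of the two values is [u - v] times a cofactor
    congruent modulo [q] to the derivative at [v], hence prime to [q]. *)
Lemma quartic_form_lift (p q j : nat) (a b u v : int) :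
  prime p -> a ^+ 2 + b ^+ 2 = p%:Z -> prime q -> odd q -> q != p -> (0 < j)%N ->
  ((q ^ j)%N%:Z %| quartic_form a b u)%Z -> ((q ^ j)%N%:Z %| quartic_form a b v)%Z ->
  (q%:Z %| u - v)%Z -> ((q ^ j)%N%:Z %| u - v)%Z.
Proof.
move=> pp abp pq oq qp j0 Fu Fv quv.
have qj : (q%:Z %| (q ^ j)%N%:Z)%Z by rewrite dvdzE /= dvdn_exp.
have nF' := quartic_deriv_ndvd pp abp pq oq qp (dvdz_trans qj Fv).
pose d := u - v.
pose k := b * (6 * v ^+ 2 + 4 * v * d + d ^+ 2 - 6) - 4 * a * (3 * v + d).
have e : quartic_form a b u - quartic_form a b v = (u - v) * (quartic_deriv a b v + d * k).
  by rewrite /quartic_form /quartic_deriv /k /d; ring.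
have : ((q ^ j)%N%:Z %| (u - v) * (quartic_deriv a b v + d * k))%Z by rewrite -e rpredB.
rewrite Gauss_dvdzl //.
rewrite coprimezE absz_nat coprimeXl // prime_coprime //.
apply: contra nF' => h; have : (q%:Z %| quartic_deriv a b v + d * k)%Z by rewrite dvdzE.
by rewrite rpredDr // dvdz_mulr.
Qed.

(** The form is a polynomial of degree at most 4 over ['F_q]. If it were zero, [q] would divide [a]
    and [b], and [q ^ 2] would divide the prime [p]. The case [q = p] is included. *)
Lemma quartic_form_roots (p q : nat) (a b : int) (s : seq int) :
  prime p -> a ^+ 2 + b ^+ 2 = p%:Z -> prime q -> odd q ->
  (forall u, u \in s -> (q%:Z %| quartic_form a b u)%Z) ->
  {in s &, forall u v, (q%:Z %| u - v)%Z -> u = v} -> uniq s -> (size s <= 4)%N.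
Proof.
move=> pp abp pq oq Fs inj us.
have F0 (x : int) : (x%:~R == 0 :> 'F_q) = (q%:Z %| x)%Z.
  by rewrite (dvdz_pcharf (pchar_Fp pq)).
pose c := [:: b%:~R; (4 * a)%:~R; (- 6 * b)%:~R; (- 4 * a)%:~R; b%:~R] : seq 'F_q.
pose P := \poly_(i < 5) c`_i.
have PE u : P.[u%:~R] = (quartic_form a b u)%:~R.
  rewrite horner_poly !big_ord_recl big_ord0 /c /= /bump /= /quartic_form; ring.
have P0 : P != 0.
  apply/eqP => P0; have := coef_poly 5 (fun i => c`_i) 4; have := coef_poly 5 (fun i => c`_i) 3.
  rewrite -/P P0 !coef0 /c /= => /esym /eqP; rewrite F0 => qa /esym /eqP; rewrite F0 => qb.
  have {}qa : (q%:Z %| a)%Z.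
    move: qa; rewrite mulNr rpredN (_ : 4 = 2 ^+ 2) // Euclid_dvdz //.
    by rewrite (negPf (dvdz_odd_prime 2 pq oq)).
  have : (q%:Z ^+ 2 %| p%:Z)%Z by rewrite -abp rpredD // dvdz_exp2r.
  rewrite dvdzE abszX /= => h.
  have : (q %| p)%N by apply: dvdn_trans h; rewrite dvdn_exp.
  rewrite dvdn_prime2 // => /eqP qp; move: h; rewrite qp.
  by rewrite -[X in (_ %| X)%N]expn1 dvdn_Pexp2l // prime_gt1.
pose rs := [seq (u%:~R : 'F_q) | u <- s].
have : (size rs < size P)%N.
  apply: max_poly_roots => //.
    apply/allP => x /mapP [u us' ->]; rewrite /root PE F0; exact: Fs.
  rewrite map_inj_in_uniq // => u v us' vs uv; apply: inj => //.
  by rewrite -F0 rmorphB /= uv subrr.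
by rewrite size_map => /leq_trans /(_ (size_poly _ _)).
Qed.

(** * Values of the form on an interval of arguments *)

Lemma PoszX (m k : nat) : (m ^ k)%N%:Z = m%:Z ^+ k.
Proof. by elim: k => // k IH; rewrite expnS exprS PoszM IH. Qed.

Lemma count_iota_window (a : pred nat) (Q c k s n : nat) :
  (forall s, (count a (iota s Q) <= c)%N) -> (n <= k * Q)%N ->
  (count a (iota s n) <= c * k)%N.
Proof.
move=> aQ; elim: k s n => [|k IH] s n; first by rewrite mul0n leqn0 => /eqP ->.
move=> nk; case: (leqP n Q) => nQ.
  rewrite mulnS; apply: leq_trans (leq_addr _ _); apply: leq_trans (aQ s).
  by rewrite -[in leqRHS](subnKC nQ) iotaD count_cat leq_addr.
rewrite -(subnKC (ltnW nQ)) iotaD count_cat mulnS; apply: leq_add => //.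
by apply: IH; rewrite leq_subLR -mulSn.
Qed.

(* The residue class of [u] modulo 4 for which 16 does not divide [quartic_form a b u]. *)
Definition form_arg (b : int) (t : nat) : int :=
  4 * t%:Z + (if (16 %| b)%Z then 2 else 0).

(** If 16 does not divide [b], the form at [4 * t] is congruent to [b] modulo 16. Otherwise [a] is
    odd and the form at [4 * t + 2] is congruent to 8. *)
Lemma quartic_form_ndvd16 (p : nat) (a b : int) (t : nat) :
  odd p -> a ^+ 2 + b ^+ 2 = p%:Z -> ~~ (16 %| quartic_form a b (form_arg b t))%Z.
Proof.
move=> op abp; rewrite /form_arg /quartic_form; case: ifPn => [/dvdzP [c bc] | nb].
  have [m am] : exists m, a = 2 * m + 1.
    by exists (a %/ 2)%Z; move: abp; rewrite bc; lia.
  set u := 4 * t%:Z + 2.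
  have -> : b * (u ^+ 4 - 6 * u ^+ 2 + 1) - 4 * a * (u ^+ 3 - u) =
     16 * (c * (u ^+ 4 - 6 * u ^+ 2 + 1) - m * (2 * t%:Z + 1) * (u ^+ 2 - 1)
        - (t%:Z * (u ^+ 2 - 1) + 2 * (2 * t%:Z + 1) ^+ 2 - 1)) - 8.
    rewrite bc am /u; ring.
  lia.
have -> : b * ((4 * t%:Z + 0) ^+ 4 - 6 * (4 * t%:Z + 0) ^+ 2 + 1) -
  4 * a * ((4 * t%:Z + 0) ^+ 3 - (4 * t%:Z + 0)) =
  b + 16 * (b * (16 * t%:Z ^+ 4 - 6 * t%:Z ^+ 2) - a * (16 * t%:Z ^+ 3 - t%:Z)) by ring.
by rewrite rpredDr // dvdz_mulr.
Qed.

Lemma dist_lt_window (s Q t t' : nat) :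
  (s <= t < s + Q)%N -> (s <= t' < s + Q)%N -> (`|t%:Z - t'%:Z| < Q)%N.
Proof. lia. Qed.

Lemma quartic_form_window (p q j s : nat) (a b : int) :
  prime p -> a ^+ 2 + b ^+ 2 = p%:Z -> prime q -> odd q -> (0 < j)%N ->
  (q != p) || (j == 1)%N ->
  (count (fun t => (q ^ j)%N%:Z %| quartic_form a b (form_arg b t))%Z (iota s (q ^ j)) <= 4)%N.
Proof.
move=> pp abp pq oq j0 qpj; rewrite -size_filter.
set l := [seq t <- _ | _].
have qj : (q%:Z %| (q ^ j)%N%:Z)%Z by rewrite dvdzE /= dvdn_exp.
have argB t t' : form_arg b t - form_arg b t' = 2 ^+ 2 * (t%:Z - t'%:Z).
  by rewrite /form_arg; ring.
have argI : injective (form_arg b).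
  by move=> t t' h; move: (argB t t'); rewrite h subrr; lia.
have lP t : t \in l -> (s <= t < s + q ^ j)%N /\ ((q ^ j)%N%:Z %| quartic_form a b (form_arg b t))%Z.
  by rewrite mem_filter mem_iota => /andP [].
rewrite -(size_map (form_arg b)).
apply: (quartic_form_roots pp abp pq oq).
- by move=> u /mapP [t /lP [_ h] ->]; apply: dvdz_trans h.
- move=> u v /mapP [t /lP [rt ht] ->] /mapP [t' /lP [rt' ht'] ->] h.
  have {}h : ((q ^ j)%N%:Z %| form_arg b t - form_arg b t')%Z.
    case/orP: qpj => [qp | /eqP j1]; last by rewrite j1 expn1.
    exact: (quartic_form_lift pp abp pq oq qp j0 ht ht' h).
  congr form_arg; move: h; rewrite argB Gauss_dvdzr; last first.
    by rewrite coprimezE absz_nat abszX coprimeXl // coprimeXr // coprimen2.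
  rewrite dvdzE /=; move: rt rt'; move: (q ^ j)%N => Q rt rt' hQ.
  case: (posnP `|t%:Z - t'%:Z|%N) => [/eqP|d0].
    by rewrite absz_eq0 subr_eq0 => /eqP [].
  by have := dvdn_leq d0 hQ; rewrite leqNgt (dist_lt_window rt rt').
- by rewrite map_inj_uniq // filter_uniq // iota_uniq.
Qed.

(** With coefficients [- A] and [B] both terms are nonnegative, so nothing cancels. Their cofactors
    lie between [u ^ 3] and [u ^ 4], where [4 * T <= u <= 8 * T]; and [4096 = 8 ^ 4]. *)
Lemma quartic_form_bounds (A B T t : nat) : (1 < T)%N -> (T <= t < T + T)%N ->
  (0 < A + B)%N ->
  ((A + B) * T ^ 3 <= `|quartic_form (- A%:Z) B%:Z (form_arg B%:Z t)| <= (A + B) * 4096 * T ^ 4)%N.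
Proof.
move=> T1 tT AB0.
have [u -> [u1 u2]] : exists2 u : nat, form_arg B t = u%:Z & (4 * T <= u /\ u <= 8 * T)%N.
  rewrite /form_arg; case: ifP => _.
    by exists (4 * t + 2)%N; [rewrite PoszD PoszM | lia].
  by exists (4 * t)%N; [rewrite addr0 PoszM | lia].
pose E := (u ^ 4 + 1 - 6 * u ^ 2)%N; pose D := (4 * (u ^ 3 - u))%N.
have h6 : (6 * u ^ 2 <= u ^ 4)%N.
  by rewrite (_ : 4 = 2 + 2)%N // expnD leq_mul2r; apply/orP; right; rewrite expnS expn1; nia.
have h3 : (u <= u ^ 3)%N by rewrite -{1}(expn1 u) leq_pexp2l //; lia.
have -> : `|quartic_form (- A%:Z) B%:Z u%:Z|%N = (B * E + A * D)%N.
  have -> : quartic_form (- A%:Z) B%:Z u%:Z = (B * E + A * D)%N%:Z; last by [].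
  rewrite /quartic_form /E /D PoszD !PoszM -!subzn ?PoszD ?PoszM ?(leq_trans h6) //; last by rewrite leq_addr.
  ring.
have uT3 : (T ^ 3 <= u ^ 3)%N by rewrite leq_exp2r //; lia.
have u3 : (u ^ 3 <= E)%N.
  rewrite /E -addnBAC //; apply: leq_trans (leq_addr _ _).
  have -> : (u ^ 3 = u * u ^ 2)%N by rewrite -expnS.
  have -> : (u ^ 4 = u ^ 2 * u ^ 2)%N by rewrite -expnD.
  rewrite leq_subRL -?mulnDl; last by rewrite leq_mul2r; apply/orP; right; rewrite expnS expn1; nia.
  by rewrite leq_mul2r; apply/orP; right; rewrite expnS expn1; nia.
have u3' : (u ^ 3 <= D)%N.
  rewrite /D; have : (2 * u <= u ^ 3)%N by rewrite expnSr leq_mul2r (_ : 2 <= u ^ 2)%N ?orbT // expnS expn1; nia.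
  lia.
have u4 : (u ^ 4 <= 4096 * T ^ 4)%N.
  by rewrite (_ : 4096 = 8 ^ 4)%N // -expnMn leq_exp2r.
have u34 : (4 * u ^ 3 <= u ^ 4)%N by rewrite [X in (_ <= X)%N]expnS leq_mul2r; apply/orP; right; lia.
have uE : (E <= u ^ 4)%N.
  have : (0 < u ^ 2)%N by rewrite expn_gt0; lia.
  rewrite /E; lia.
have uD : (D <= u ^ 4)%N by rewrite /D; lia.
rewrite mulnDl addnC -mulnA mulnDl [(A * (4096 * _) + _)%N]addnC.
by apply/andP; split; apply: leq_add; rewrite leq_mul2l; apply/orP; right; lia.
Qed.

(** The left side bounds the product of the values from below: each is at least [(A + B) * T ^ 3],
    and at most [4 * (T %/ p).+1] of them are divisible by [p]. *)
Theorem good_primes_bound (p A B T M N : nat) (S : seq nat) :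
  prime p -> odd p -> (A ^ 2 + B ^ 2 = p)%N -> (T = N * M)%N -> (0 < N)%N -> (1 < T)%N ->
  let X := ((A + B) * 4096 * T ^ 4)%N in
  (forall (q : nat) (u : int), prime q -> odd q -> q != p -> (q <= X)%N ->
     (q%:Z %| quartic_form (- A%:Z) B%:Z u)%Z -> q \in S) ->
  (((A + B) * T ^ 3) ^ (T - 4 * (T %/ p).+1) <=
    8 ^ T * X.+1 ^ (4 * M.+1 * size S) * N ^ (12 * T))%N.
Proof.
move=> pp op ABp TNM N0 T1 X HS.
have abp : (- A%:Z) ^+ 2 + B%:Z ^+ 2 = p%:Z by rewrite sqrrN -ABp PoszD !PoszX.
have AB0 : (0 < A + B)%N by move: pp; rewrite -ABp; case: (A) (B) => [|?] [|?].
pose g t := `|quartic_form (- A%:Z) B%:Z (form_arg B%:Z t)|%N.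
have gb t : (T <= t < T + T)%N -> ((A + B) * T ^ 3 <= g t <= X)%N.
  by move=> tT; apply: quartic_form_bounds.
have Y0 : (0 < (A + B) * T ^ 3)%N by rewrite muln_gt0 AB0 expn_gt0; lia.
have gc q j : prime q -> odd q -> (0 < j)%N -> (q != p) || (j == 1)%N ->
    (count (fun t => q ^ j %| g t)%N (iota T T) <= 4 * (T %/ q ^ j).+1)%N.
  move=> pq oq j0 qpj; apply: (@count_iota_window _ (q ^ j)).
    by move=> s; have := quartic_form_window s pp abp pq oq j0 qpj.
  by rewrite ltnW // ltn_ceil // expn_gt0 prime_gt0.
have := @prod_smooth_bound g p T M N X S TNM N0.
move=> /(_ _ _ _ _) H.
apply: leq_trans (H _ _ _ _); first last.
- move=> q t tT pq oq qp qt; apply: (HS q (form_arg B t)) => //.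
  have /andP [h1 h2] := gb t tT.
  by apply: leq_trans h2; apply: dvdn_leq qt; apply: leq_trans h1.
- by move=> q j pq oq qp j0; apply: gc; rewrite ?qp.
- by move=> t _; have := quartic_form_ndvd16 t op abp; rewrite dvdzE.
- by move=> t /gb /andP [h1 ->]; rewrite (leq_trans Y0 h1).
set G := [seq t <- _ | _].
have sG : (T - 4 * (T %/ p).+1 <= size G)%N.
  have := gc p 1%N pp op isT; rewrite eqxx orbT expn1 => /(_ isT) h.
  have := count_predC (fun t => p %| g t)%N (iota T T).
  rewrite size_iota /G size_filter leq_subLR => e; rewrite -{1}e.
  exact: leq_add h (leqnn _).
apply: leq_trans (_ : ((A + B) * T ^ 3) ^ size G <= _)%N; first by rewrite leq_pexp2l.
rewrite -iter_muln_1 -[size G]count_predT -big_const_seq big_seq [X in (_ <= X)%N]big_seq.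
apply: leq_prod => t; rewrite mem_filter mem_iota => /andP [_ tT].
by have /andP [] := gb t tT.
Qed.

(** [A] and [B] are the absolute values of the two parts of the Jacobi sum. Changing the sign of one
    coefficient amounts to replacing [u] by [- u], up to the sign of the form, so the signs needed
    for the size estimates can be imposed. *)
Lemma sum_squares_quartic_residues (p : nat) :
  prime p -> (p %% 4)%N = 1%N ->
  exists A B : nat, (A ^ 2 + B ^ 2 = p)%N /\
    forall (q : nat) (u : int), prime q -> odd q -> q != p ->
      (q%:Z %| quartic_form (- A%:Z) B%:Z u)%Z ->
      exists2 y : nat, ~~ (p %| y)%N &
        if (q %% 4)%N == 1%N then q = y ^ 4 %[mod p] else (p %| q + y ^ 4)%N.
Proof.
move=> pp p4; have [e He] := quartic_log_exists pp p4.
have JN := jacobi_norm pp p4 He.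
set a := jacobi_re e in JN; set b := jacobi_im e in JN.
exists `|a|%N, `|b|%N; split.
  suff : (`|a| ^ 2 + `|b| ^ 2)%N%:Z = p%:Z by case.
  by rewrite PoszD !PoszX !abszE !real_normK ?num_real.
move=> q u pq oq qp qF.
have [v qv] : exists v, (q%:Z %| quartic_form a b v)%Z.
  have fN x y w : quartic_form (- x) (- y) w = - quartic_form x y w by rewrite /quartic_form; ring.
  have fC x y w : quartic_form x (- y) w = - quartic_form x y (- w) by rewrite /quartic_form; ring.
  move: qF; rewrite !abszE; case: (ger0P a) => _; case: (ger0P b) => _.
  - by exists (- u); rewrite -rpredN -fC -rpredN -fN opprK.
  - by exists u; rewrite -rpredN -fN.
  - by rewrite opprK; exists u.
  - by rewrite opprK fC rpredN => h; exists (- u).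
have [y y0 yq] := quartic_reciprocity pp p4 He pq oq qp qv.
exists y; first by rewrite (dvdn_pcharf (pchar_Fp pp)) natr_Zp.
move: yq; case: ifP => _ h.
  by rewrite -!(val_Fp_nat pp) natrX natr_Zp h.
by rewrite (dvdn_pcharf (pchar_Fp pp)) natrD natrX natr_Zp -h subrr.
Qed.
End QuarticForm.

(** * Transfer to the standard integers and real logarithms *)

Section Transfer.
Import all_boot zify.
Local Set Implicit Arguments.
Local Unset Strict Implicit.
Local Close Scope R_scope.

Lemma prime_Z_of_nat (q : nat) : prime q -> Znumtheory.prime (Z.of_nat q).
Proof.
move=> pq; apply prime_alt; split; first by have := prime_gt1 pq; lia.
move=> n [n1 nq] [k hk].
have /primeP [_ h] := pq.
have : (Z.to_nat n %| q)%N by apply/dvdnP; exists (Z.to_nat k); nia.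
move/h => /orP [/eqP | /eqP]; lia.
Qed.

Lemma prime_Z_to_nat (q : Z) : Znumtheory.prime q -> prime (Z.to_nat q).
Proof.
move=> /prime_alt [q1 h]; apply/primeP; split; first by lia.
move=> d /dvdnP [k hk]; have [d1|d1] := leqP d 1.
  by case: d d1 hk => [|[|//]] _ hk //; lia.
case: (ltnP d (Z.to_nat q)) => dq.
  by case: (h (Z.of_nat d)); [lia | exists (Z.of_nat k); lia].
have k1 : k = 1%N by nia.
by apply/orP; right; apply/eqP; lia.
Qed.

Lemma biquad_res_of_nat (p q y : nat) : prime p -> odd q -> ~~ (p %| y)%N ->
  (if (q %% 4)%N == 1%N then q = y ^ 4 %[mod p] else (p %| q + y ^ 4)%N) ->
  biquad_res (qstar (Z.of_nat q)) (Z.of_nat p).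
Proof.
move=> pp oq py h; have p0 := prime_gt0 pp.
have Y4 : Z.of_nat (y ^ 4)%N = (Z.of_nat y ^ 4)%Z.
  by rewrite !expnS expn0; lia.
exists (Z.of_nat y); split.
  move=> [k hk]; move/negP: py; apply; apply/dvdnP.
  by exists (Z.to_nat k); nia.
apply/Z.mod_divide; first by lia.
rewrite -Y4 /qstar; move: h; case: eqP => q4 h.
  have -> : Z.even ((Z.of_nat q - 1) / 2) = true.
    have -> : Z.of_nat q = (2 * (2 * Z.of_nat (q %/ 4)) + 1)%Z by lia.
    rewrite Z.add_simpl_r Z.mul_comm Z.div_mul // Z.even_spec.
    by exists (Z.of_nat (q %/ 4)).
  exists (Z.of_nat (q %/ p) - Z.of_nat (y ^ 4 %/ p))%Z.
  rewrite {1}(divn_eq q p) {1}(divn_eq (y ^ 4) p) h.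
  by move: (q %/ p)%N (y ^ 4 %/ p)%N (y ^ 4 %% p)%N => a b c; nia.
have -> : Z.even ((Z.of_nat q - 1) / 2) = false.
  have -> : Z.of_nat q = (2 * (2 * Z.of_nat (q %/ 4) + 1) + 1)%Z by lia.
  rewrite Z.add_simpl_r Z.mul_comm Z.div_mul // -Z.negb_odd.
  by apply/negbTE; rewrite negbK; apply/Z.odd_spec; exists (Z.of_nat (q %/ 4)).
move/dvdnP: h => [k hk]; exists (- Z.of_nat k)%Z.
by move: hk; move: (y ^ 4)%N => a; nia.
Qed.

Lemma INR_expn (m k : nat) : INR (m ^ k)%N = pow (INR m) k.
Proof. by elim: k => // k IH; rewrite expnS mult_INR IH. Qed.

Local Open Scope R_scope.

Lemma ln_le (x y : R) : 0 < x -> x <= y -> ln x <= ln y.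
Proof.
by move=> x0 [/(ln_increasing _ _ x0) | ->]; [apply: Rlt_le | apply: Rle_refl].
Qed.

(** Logarithms are taken in [good_primes_bound], with [l] any list containing the admissible primes
    up to the size of the form values. *)
Lemma many_good_primes (p : Z) : Znumtheory.prime p -> Z.modulo p 4 = 1%Z -> (80 <= p)%Z ->
  exists A B : nat, INR A ^ 2 + INR B ^ 2 = IZR p /\
  forall (T M N : nat) (l : list Z), T = (N * M)%coq_nat -> (0 < N)%coq_nat -> (80 <= T)%coq_nat ->
  (forall q, Znumtheory.prime q -> Z.odd q = true ->
     IZR q <= (INR A + INR B) * 4096 * INR T ^ 4 -> biquad_res (qstar q) p -> In q l) ->
  9 / 10 * INR T * ln ((INR A + INR B) * INR T ^ 3) <=
    INR T * ln 8
    + 4 * (INR M + 1) * INR (length l) * ln ((INR A + INR B) * 4096 * INR T ^ 4 + 1)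
    + 12 * INR T * ln (INR N).
Proof.
move=> pp p4 p80.
have pn := prime_Z_to_nat pp; set n := Z.to_nat p in pn.
have pE : p = Z.of_nat n by rewrite /n; lia.
have n4 : (n %% 4 = 1)%N by have := Z.div_mod p 4; rewrite p4; lia.
have on : odd n by rewrite (divn_eq n 4) n4 oddD oddM andbF.
have [A [B [AB HAB]]] := sum_squares_quartic_residues pn n4.
exists A, B; split.
  by rewrite pE -INR_IZR_INZ -AB plus_INR !INR_expn.
move=> T M N l TNM N0 T80 Hl.
pose S := [seq Z.to_nat q | q <- l].
have := @good_primes_bound n A B T M N S pn on AB.
have T1 : (1 < T)%N by lia.
have N0' : (0 < N)%N by lia.
move=> /(_ TNM N0' T1) /=.
set X := ((A + B) * 4096 * T ^ 4)%N.
have XE : INR X = (INR A + INR B) * 4096 * INR T ^ 4.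
  rewrite /X mult_INR mult_INR plus_INR INR_expn; congr (_ * _ * _).
  by rewrite INR_IZR_INZ.
rewrite -XE in Hl *.
set Y := ((A + B) * T ^ 3)%N; set e := (T - 4 * (T %/ n).+1)%N.
have YE : INR Y = (INR A + INR B) * pow (INR T) 3.
  by rewrite /Y mult_INR plus_INR INR_expn.
move=> H; apply: (fun a b => b (H a)) => [q u pq oq qp qX qF|{}H].
  have [y py yq] := HAB q u pq oq qp qF.
  have : In (Z.of_nat q) l.
    apply: Hl.
    - exact: prime_Z_of_nat.
    - apply/Z.odd_spec; exists (Z.of_nat (q %/ 2)); clear -oq; lia.
    - by rewrite -INR_IZR_INZ; apply: le_INR; apply/leP.
    - by rewrite pE; apply: biquad_res_of_nat py yq.
  rewrite /S; elim: (l) => //= x l' IH [-> | /IH h]; rewrite inE ?h ?orbT //.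
  by rewrite Nat2Z.id eqxx.
(* As [p] and [T] are at least 80, the loss [4 * (T %/ n).+1] is at most [T / 20 + 4 <= T / 10]. *)
have e9 : (9 * T <= 10 * e)%N.
  have h1 : (80 * (T %/ n) <= T)%N.
    by apply: leq_trans (leq_trunc_div T n); rewrite mulnC leq_mul2l; apply/orP; right; lia.
  by rewrite /e; move: h1; move: (T %/ n)%N => d; lia.
have Y1 : 1 <= INR Y.
  have AB0 : (0 < A + B)%N by move: pn; rewrite -AB; case: (A) (B) => [|?] [|?].
  rewrite -[1]/(INR 1); apply: le_INR; apply/leP.
  by rewrite /Y muln_gt0 AB0 expn_gt0; apply/orP; left; lia.
have lnY : 0 <= ln (INR Y) by rewrite -ln_1; apply: ln_le; Lra.lra.
have NR : 0 < INR N by apply: lt_0_INR; lia.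
have XR : 0 < INR X.+1 by apply: lt_0_INR; lia.
have lnH : INR e * ln (INR Y) <= INR T * ln 8
    + INR (4 * M.+1 * size S)%N * ln (INR X.+1) + INR (12 * T)%N * ln (INR N).
  have {}H := le_INR _ _ (elimT leP H).
  have p8 : 0 < pow 8 T by apply: pow_lt; Lra.lra.
  have pX := pow_lt _ (4 * M.+1 * size S)%N XR.
  have pN := pow_lt _ (12 * T)%N NR.
  have pXM : 0 < pow 8 T * pow (INR X.+1) (4 * M.+1 * size S)%N by apply: Rmult_lt_0_compat.
  move: H; rewrite mult_INR mult_INR !INR_expn.
  have -> : INR 8 = 8 by rewrite INR_IZR_INZ.
  have pY : 0 < pow (INR Y) e by apply: pow_lt; Lra.lra.
  move=> /(ln_le pY); rewrite ln_mult // ln_mult // !ln_pow //; Lra.lra.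
have {}e9 := le_INR _ _ (elimT leP e9).
rewrite (mult_INR 9 T) (mult_INR 10 e) in e9.
rewrite (mult_INR (4 * M.+1) (size S)) (mult_INR 4 M.+1) (mult_INR 12 T) (S_INR M) (S_INR X) in lnH.
rewrite /S size_map in lnH; rewrite -YE.
have n9 : INR 9 = 9 by rewrite INR_IZR_INZ.
have n10 : INR 10 = 10 by rewrite INR_IZR_INZ.
have n4R : INR 4 = 4 by rewrite INR_IZR_INZ.
have n12 : INR 12 = 12 by rewrite INR_IZR_INZ.
rewrite n9 n10 in e9; rewrite n4R n12 in lnH.
apply: Rle_trans lnH; apply: Rmult_le_compat_r => //; Lra.lra.
Qed.
End Transfer.

(** * Real estimates *)

(** Excluded middle decides membership, since [counted_set] comes without a decision procedure. *)
Lemma finite_Z_set (P : Z -> Prop) (b : nat) :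
  (forall q, P q -> (0 <= q < Z.of_nat b)%Z) ->
  exists l : list Z, NoDup l /\ (forall q, In q l <-> P q).
Proof.
  revert P; induction b as [|b IH]; intros P HP.
  - exists nil; split; [constructor|]; intros q; split; [intros []|].
    intros H; specialize (HP q H); lia.
  - destruct (IH (fun q => P q /\ q <> Z.of_nat b)) as [l [nl hl]].
    { intros q [H1 H2]; specialize (HP q H1); lia. }
    destruct (classic (P (Z.of_nat b))) as [Hb|Hb].
    + exists (Z.of_nat b :: l); split.
      * constructor; trivial; rewrite hl; tauto.
      * intros q; simpl; rewrite hl; split.
        -- intros [<-|[H _]]; trivial.
        -- intros H; destruct (Z.eq_dec (Z.of_nat b) q); [left | right]; auto.
    + exists l; split; trivial; intros q; rewrite hl; split; [tauto|].
      intros H; split; trivial; intros ->; contradiction.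
Qed.

Lemma nat_floor (x : R) : 0 <= x -> exists n : nat, INR n <= x < INR n + 1.
Proof.
  intros hx; destruct (archimed x) as [h1 h2].
  assert (h : (0 < up x)%Z) by (apply lt_IZR; lra).
  exists (Z.to_nat (up x - 1)).
  rewrite INR_IZR_INZ, Z2Nat.id, minus_IZR by lia; lra.
Qed.

Lemma pow2_le_exp (n : nat) : 2 ^ n <= exp (INR n).
Proof.
  induction n as [|n IH]; [simpl; rewrite exp_0; lra|].
  rewrite S_INR, exp_plus; simpl.
  pose proof (exp_ineq1_le 1); pose proof (exp_pos (INR n)); nra.
Qed.

Lemma ln_le_of_le_exp (x y : R) : 0 < x -> x <= exp y -> ln x <= y.
Proof. intros hx h; rewrite <- (ln_exp y); apply ln_le; trivial. Qed.

Lemma le_ln_of_exp_le (x y : R) : exp y <= x -> y <= ln x.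
Proof. intros h; rewrite <- (ln_exp y); apply ln_le; trivial; apply exp_pos. Qed.

Lemma exp_le (x y : R) : x <= y -> exp x <= exp y.
Proof. intros [h| ->]; [left; apply exp_increasing; trivial | right; trivial]. Qed.

(** Here [lam] is the logarithm of [p] and [k] the number of available primes. The form values stay
    below the bound on [q], while the inequality of [many_good_primes] is strictly reversed. *)
Lemma large_prime_contradiction (eps lam A B T M N k : R) :
  0 < eps -> 220 + 70 / eps <= lam ->
  0 <= A -> 0 <= B -> A ^ 2 + B ^ 2 = exp lam ->
  100 * exp (eps * lam / 50) <= N <= 101 * exp (eps * lam / 50) ->
  1 <= M -> T = N * M -> exp (eps * lam / 5) / 2 <= T <= exp (eps * lam / 5) ->
  0 <= k <= exp (eps * lam / 50) ->
  (A + B) * 4096 * T ^ 4 < exp ((/ 2 + eps) * lam) /\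
  T * ln 8 + 4 * (M + 1) * k * ln ((A + B) * 4096 * T ^ 4 + 1) + 12 * T * ln N
    < 9 / 10 * T * ln ((A + B) * T ^ 3).
Proof.
  intros he hl hA hB hAB hN hM hT hTE hk.
  assert (hel : 70 <= eps * lam).
  { replace 70 with (eps * (70 / eps)) by (field; lra).
    apply Rmult_le_compat_l; lra. }
  assert (hl0 : 220 <= lam).
  { assert (0 < 70 / eps) by (apply Rdiv_lt_0_compat; lra); lra. }
  set (E := exp (eps * lam / 5)) in *.
  set (K := exp (eps * lam / 50)) in *.
  set (H := exp (lam / 2)).
  assert (HH : H * H = exp lam) by (unfold H; rewrite <- exp_plus; f_equal; field).
  assert (H0 : 0 < H) by apply exp_pos.
  assert (K1 : 1 <= K).
  { unfold K; rewrite <- exp_0; apply exp_le; lra. }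
  (* [16384 = 4 * 4096] is what [XW] below requires; it is [2 ^ 14], and [14 = 70 / 5]. *)
  assert (E1 : 16384 <= E).
  { apply Rle_trans with (exp (INR 14)).
    - pose proof (pow2_le_exp 14) as h; lra.
    - apply exp_le; simpl; lra. }
  assert (ABl : H <= A + B) by nra.
  assert (ABu : A + B <= 2 * H).
  { apply Rsqr_incr_0; unfold Rsqr; [|lra|lra].
    pose proof (Rle_0_sqr (A - B)); unfold Rsqr in *; nra. }
  set (W := exp ((/ 2 + eps) * lam)).
  assert (WE : W = H * E ^ 5).
  { unfold W, H, E; rewrite <- Rpower_pow by apply exp_pos; unfold Rpower.
    rewrite ln_exp, <- exp_plus; f_equal; simpl; field. }
  assert (E40 : 0 < E ^ 4) by (apply pow_lt; lra).
  assert (T4 : T ^ 4 <= E ^ 4) by (apply pow_incr; lra).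
  assert (T40 : 0 < T ^ 4) by (apply pow_lt; lra).
  assert (T30 : 0 < T ^ 3) by (apply pow_lt; lra).
  assert (XW : (A + B) * 4096 * T ^ 4 <= W / 2).
  { rewrite WE; replace (E ^ 5) with (E * E ^ 4) by ring.
    apply Rle_trans with (2 * H * 4096 * E ^ 4).
    - apply Rmult_le_compat; try lra; nra.
    - assert (0 < H * E ^ 4) by (apply Rmult_lt_0_compat; lra); nra. }
  assert (W2 : 2 <= W).
  { apply Rle_trans with E; [lra|]; unfold E, W; apply exp_le; nra. }
  split; [lra|].
  assert (X0 : 0 < (A + B) * 4096 * T ^ 4) by (apply Rmult_lt_0_compat; lra).
  assert (lnX : ln ((A + B) * 4096 * T ^ 4 + 1) <= (/ 2 + eps) * lam).
  { apply ln_le_of_le_exp; fold W; lra. }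
  assert (lnX0 : 0 <= ln ((A + B) * 4096 * T ^ 4 + 1)).
  { apply le_ln_of_exp_le; rewrite exp_0; lra. }
  assert (lnN : ln N <= 7 + eps * lam / 50).
  { apply ln_le_of_le_exp; [lra|]; rewrite exp_plus; fold K.
    pose proof (pow2_le_exp 7) as h.
    replace (INR 7) with 7 in h by (simpl; lra); nra. }
  assert (ln8 : ln 8 <= 3).
  { apply ln_le_of_le_exp; [lra|]; pose proof (pow2_le_exp 3) as h.
    replace (INR 3) with 3 in h by (simpl; lra); lra. }
  assert (lnT : eps * lam / 5 - 1 <= ln T).
  { apply le_ln_of_exp_le; apply Rle_trans with (E / 2); [|lra].
    unfold Rminus; rewrite exp_plus, exp_Ropp; fold E; unfold Rdiv.
    apply Rmult_le_compat_l; [lra|]; apply Rinv_le_contravar; [lra|].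
    pose proof (exp_ineq1_le 1); lra. }
  assert (lnY : lam / 2 + 3 * (eps * lam / 5 - 1) <= ln ((A + B) * T ^ 3)).
  { rewrite ln_mult, ln_pow by lra.
    assert (lam / 2 <= ln (A + B)) by (apply le_ln_of_exp_le; exact ABl).
    replace (INR 3) with 3 by (simpl; lra); lra. }
  (* Here [M + 1 <= 2 * M] and [k <= K <= N / 100]. *)
  assert (hMk : 4 * (M + 1) * k <= 8 / 100 * T) by (rewrite hT; nra).
  assert (t2 : 4 * (M + 1) * k * ln ((A + B) * 4096 * T ^ 4 + 1)
     <= 8 / 100 * T * ((/ 2 + eps) * lam)).
  { apply Rmult_le_compat; trivial.
    apply Rmult_le_pos; lra. }
  assert (T0 : 0 < T) by lra.
  (* The left side is at most [87 + 0.04 * lam + 0.32 * eps * lam], the right side at least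
     [0.45 * lam + 0.54 * eps * lam - 2.7]; [lam >= 220] gives [0.41 * lam > 89.7]. *)
  assert (h : ln 8 + 8 / 100 * ((/ 2 + eps) * lam) + 12 * ln N
     < 9 / 10 * ln ((A + B) * T ^ 3)) by lra.
  apply (Rmult_lt_compat_l T) in h; trivial; lra.
Qed.

(** * Choice of the parameters and conclusion *)

Theorem theorem2 :
  forall eps : R, 0 < eps ->
  exists p0 : R,
    forall p : Z, prime p -> Z.modulo p 4 = 1%Z -> IZR p > p0 ->
      exists l : list Z,
        NoDup l /\ (forall q, In q l <-> counted_set p eps q) /\
        INR (length l) > Rpower (IZR p) (eps / 50).
Proof.
  (* The term 220 outweighs the absolute constants in the final comparison, and [70 / eps] ensures
     [eps * lam >= 70]. *)
  intros eps he; exists (exp (220 + 70 / eps)); intros p pp p4 hp.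
  assert (p0 : 0 < IZR p) by (pose proof (exp_pos (220 + 70 / eps)); lra).
  set (lam := ln (IZR p)).
  assert (hlam : 220 + 70 / eps <= lam) by (apply le_ln_of_exp_le; lra).
  assert (elam : exp lam = IZR p) by (apply exp_ln; trivial).
  assert (hd : 0 < 70 / eps) by (apply Rdiv_lt_0_compat; lra).
  assert (hel : 70 <= eps * lam).
  { replace 70 with (eps * (70 / eps)) by (field; lra).
    apply Rmult_le_compat_l; lra. }
  assert (p80 : (80 <= p)%Z).
  { apply le_IZR; pose proof (exp_ineq1_le (220 + 70 / eps)); lra. }
  destruct (finite_Z_set (counted_set p eps)
      (Z.to_nat (up (Rpower (IZR p) (/ 2 + eps))))) as [l [nl hl]].
  { intros q [hq [_ [hq2 _]]]; apply prime_ge_2 in hq.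
    destruct (archimed (Rpower (IZR p) (/ 2 + eps))) as [h _].
    assert (q < up (Rpower (IZR p) (/ 2 + eps)))%Z by (apply lt_IZR; lra); lia. }
  exists l; split; [trivial|split; [trivial|]].
  apply Rnot_le_gt; intros hk.
  replace (Rpower (IZR p) (eps / 50)) with (exp (eps * lam / 50)) in hk
    by (unfold Rpower, lam; f_equal; field).
  set (K := exp (eps * lam / 50)) in *; set (E := exp (eps * lam / 5)).
  assert (K1 : 1 <= K).
  { unfold K; rewrite <- exp_0; apply exp_le; lra. }
  (* Since [N <= 101 * K], this gives [E / N >= 2], so rounding [E / N] down to [M] keeps [N * M] at
     least [E / 2]. *)
  assert (EK : 202 * K <= E).
  { replace E with (exp (9 * (eps * lam) / 50) * K)
      by (unfold E, K; rewrite <- exp_plus; f_equal; field).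
    apply Rmult_le_compat_r; [lra|].
    pose proof (pow2_le_exp 8) as h.
    apply Rle_trans with (exp (INR 8)); [lra | apply exp_le; simpl; lra]. }
  assert (E1 : 16384 <= E).
  { pose proof (pow2_le_exp 14) as h.
    apply Rle_trans with (exp (INR 14)); [lra | apply exp_le; simpl; lra]. }
  (* [N] is one more than the floor, so that it is at least [100 * K]; the extra 1 is absorbed by
     [K >= 1]. *)
  destruct (nat_floor (100 * K)) as [N' hN']; [lra|].
  set (N := S N'); assert (hN : 100 * K <= INR N <= 101 * K).
  { unfold N; rewrite S_INR; lra. }
  destruct (nat_floor (E / INR N)) as [M hM].
  { apply Rlt_le, Rdiv_lt_0_compat; lra. }
  assert (N0 : 0 < INR N) by lra.
  assert (EN : E / INR N * INR N = E) by (field; lra).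
  assert (hT : E / 2 <= INR N * INR M <= E) by nra.
  assert (M1 : 1 <= INR M).
  { destruct M as [|M]; [simpl in hT; lra|].
    rewrite S_INR; pose proof (pos_INR M); lra. }
  destruct (many_good_primes pp p4 p80) as [A [B [hAB key]]].
  destruct (large_prime_contradiction eps lam (INR A) (INR B) (INR N * INR M) (INR M)
     (INR N) (INR (length l))) as [h1 h2]; trivial; try apply pos_INR.
  { rewrite elam; trivial. }
  { split; [apply pos_INR | trivial]. }
  specialize (key (N * M)%nat M N l).
  rewrite mult_INR in key.
  apply (Rlt_irrefl (9 / 10 * (INR N * INR M) * ln ((INR A + INR B) * (INR N * INR M) ^ 3))).
  eapply Rle_lt_trans; [apply key | exact h2]; trivial.
  - unfold N; lia.
  - apply INR_le; rewrite mult_INR; replace (INR 80) with 80 by (rewrite INR_IZR_INZ; trivial); lra.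
  (* Admissible primes up to the size of the form values lie below the bound in [counted_set], by
     [h1], and so belong to [l]. *)
  - intros q hq oq hqX hb; apply hl; split; [trivial|split; [trivial|split; [|trivial]]].
    apply Rle_lt_trans with (1 := hqX); exact h1.
Qed.
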